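(* Let $R$ be a ring with proper involution $*$, let $m\ge 1$ be an integer, let $a\in R^{\overline{D}}$ and let $p=aa^{\overline{D}}$. Then, writing $t=pap$, $s=pa(1-p)$ and $n=(1-p)a(1-p)$, $$a=\begin{pmatrix} t&s\\ 0&n\end{pmatrix}_p,\qquad a^{\overline{W}_m}=\begin{pmatrix} t^{-1}&t^{-(m+1)}c_m\\ 0&0\end{pmatrix}_p,$$ where $c_1=s$ and $c_{i+1}=tc_i+sn^i$ for $i\in\mathbb{N}$.
   Context: Rings are associative with identity and $\mathbb{N}$ is the set of positive integers. An involution $*$ on $R$ satisfies $(x+y)^*=x^*+y^*$, $(xy)^*=y^*x^*$, $(x^* )^*=x$; it is proper if $x^*x=0$ implies $x=0$. An element $a\in R$ has an $m$-weak group inverse if there exist $x\in R$ and $k\in\mathbb{N}$ with $ax^2=x$, $xa^{k+1}=a^k$ and $(a^k)^*a^{m+1}x=(a^k)^*a^m$; such an $x$ is unique if it exists and is denoted $a^{\overline{W}_m}$. An element $a\in R$ has a core-EP inverse if there exist $x\in R$ and $k\in\mathbb{N}$ with $ax^2=x$, $(ax)^*=ax$, $a^k=xa^{k+1}$; such an $x$ is unique if it exists and is denoted $a^{\overline{D}}$. $R^{\overline{D}}$ is the set of core-EP invertible elements of $R$; every such element has an $m$-weak group inverse. For an idempotent $p\in R$, $\begin{pmatrix} x_{11}&x_{12}\\ x_{21}&x_{22}\end{pmatrix}_p$ denotes the Pierce decomposition of $x\in R$ relative to $p$: $x=x_{11}+x_{12}+x_{21}+x_{22}$ with $x_{11}=pxp$,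 $x_{12}=px(1-p)$, $x_{21}=(1-p)xp$, $x_{22}=(1-p)x(1-p)$. The inverse $t^{-1}$ is taken in the corner ring $pRp$ (with identity $p$), and $t^{-j}=(t^{-1})^j$. *)

(* Defs.v *)
From HB Require Import structures.
From mathcomp Require Import all_boot all_algebra.

Set Implicit Arguments.
Unset Strict Implicit.
Unset Printing Implicit Defensive.

Import GRing.Theory.
Local Open Scope ring_scope.

(* [pzRingType]: associative rings with identity, not assumed commutative and
   not excluding the zero ring. *)

Definition is_involution (R : pzRingType) (star : R -> R) : Prop :=
  [/\ forall x y, star (x + y) = star x + star y,
      forall x y, star (x * y) = star y * star x
    & forall x, star (star x) = x].

Definition is_proper_involution (R : pzRingType) (star : R -> R) : Prop :=
  is_involution star /\ (forall x, star x * x = 0 -> x = 0).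

Definition is_core_EP_inverse (R : pzRingType) (star : R -> R) (a x : R) : Prop :=
  exists k : nat,
    [/\ (0 < k)%N, a * x ^+ 2 = x, star (a * x) = a * x
      & a ^+ k = x * a ^+ k.+1].

Definition is_weak_group_inverse (R : pzRingType) (star : R -> R) (m : nat)
    (a x : R) : Prop :=
  exists k : nat,
    [/\ (0 < k)%N, a * x ^+ 2 = x, x * a ^+ k.+1 = a ^+ k
      & star (a ^+ k) * a ^+ m.+1 * x = star (a ^+ k) * a ^+ m].

(* "x is the matrix (x11 x12; x21 x22)_p", the notation presupposing that p is
   idempotent. *)
Definition is_Pierce_matrix (R : pzRingType) (p x x11 x12 x21 x22 : R) : Prop :=
  p * p = p /\ x = x11 + x12 + x21 + x22 /\
  [/\ x11 = p * x * p, x12 = p * x * (1 - p),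
      x21 = (1 - p) * x * p & x22 = (1 - p) * x * (1 - p)].

Definition in_corner (R : pzRingType) (p x : R) : Prop :=
  exists y, x = p * y * p.

Definition is_corner_inverse (R : pzRingType) (p t u : R) : Prop :=
  [/\ in_corner p t, in_corner p u, t * u = p & u * t = p].

(* Main.v *)
Require Import Defs.
From mathcomp Require Import all_boot all_algebra.
Import GRing.Theory.
Local Open Scope ring_scope.

(** The core-EP inverse [d] lies in [pRp], where it inverts [t = a p], and
    [c_i = p a^i (1 - p)] by induction.  Since [d^(m+1) a^(m+1) d = d], the
    claimed matrix [d + d^(m+1) c_m] collapses to [d^(m+1) a^m], which is
    checked to be an [m]-weak group inverse.  Conversely, if [x] is one, then
    [star (a^j) a^(m+1) x = star (a^j) a^m] multiplied on the left by
    [star (d^j)] becomes [a^(m+1) x = p a^m], because [a^j d^j = p = star p];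
    multiplying by [d^(m+1)] gives [x = d^(m+1) a^m]. *)

Lemma mulr_exp_outer (R : pzRingType) (a y : R) (j : nat) :
  a * y ^+ 2 = y -> a ^+ j * y ^+ j.+1 = y.
Proof.
move=> hy; elim: j => [|j IHj]; first by rewrite mul1r.
by rewrite exprSr -mulrA -addn2 addnC exprD (mulrA a) hy -exprS.
Qed.

Lemma mulr_exp_outerS (R : pzRingType) (a y : R) (j : nat) :
  a * y ^+ 2 = y -> a ^+ j.+1 * y ^+ j.+1 = a * y.
Proof. by move=> hy; rewrite exprS -mulrA mulr_exp_outer. Qed.

Lemma exp_mulr_absorb (R : pzRingType) (a z : R) (k j : nat) :
  z * a ^+ k.+1 = a ^+ k -> z ^+ j * a ^+ (j + k) = a ^+ k.
Proof.
move=> hz; elim: j => [|j IHj]; first by rewrite mul1r.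
by rewrite exprSr -mulrA addSnnS addnC exprD (mulrA z) hz -exprD addnC.
Qed.

(** Iterating [a * y ^+ 2 = y] puts [y] in [a ^+ k R], where [z ^+ j * a ^+ j] acts as the
    identity. *)
Lemma exp_mulr_cancel (R : pzRingType) (a y z : R) (k j : nat) :
  z * a ^+ k.+1 = a ^+ k -> a * y ^+ 2 = y -> z ^+ j * a ^+ j * y = y.
Proof.
move=> hz hy; rewrite -{1}(mulr_exp_outer R a y k hy).
by rewrite mulrA -(mulrA (z ^+ j)) -exprD exp_mulr_absorb ?mulr_exp_outer.
Qed.

Lemma proj_fix_exp (R : pzRingType) (a d : R) (k : nat) :
  a * d ^+ 2 = d -> d * a ^+ k.+1 = a ^+ k -> a * d * a ^+ k = a ^+ k.
Proof. by move=> h2 hk; rewrite -{1}hk mulrA -(mulrA a d d) -expr2 h2. Qed.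

(** Again [a ^+ j * y] lies in [a ^+ k R], which [a * d] fixes. *)
Lemma proj_fix (R : pzRingType) (a d y : R) (k j : nat) :
  a * d ^+ 2 = d -> d * a ^+ k.+1 = a ^+ k -> a * y ^+ 2 = y ->
  a * d * (a ^+ j * y) = a ^+ j * y.
Proof.
move=> h2 hk hy; rewrite -{1 2}(mulr_exp_outer R a y k hy).
by rewrite (mulrA (a ^+ j)) -exprD addnC exprD !mulrA proj_fix_exp.
Qed.

Lemma weak_group_inverse_core_EP (R : pzRingType) (star : R -> R) (m : nat)
    (a d : R) :
  is_involution star -> is_core_EP_inverse star a d -> (0 < m)%N ->
  unique (is_weak_group_inverse star m a) (d ^+ m.+1 * a ^+ m).
Proof.
move=> [_ starM _] [k [k0 h2 hp /esym hk]]; case: m => // m _; split.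
  exists k; split => //.
  - rewrite expr2 [d ^+ m.+2 * _ * _]mulrA -(mulrA (d ^+ m.+2)).
    rewrite (mulr_exp_outer _ _ _ _ h2) -exprSr mulrA.
    by rewrite -(add2n m.+1) exprD (mulrA a) h2 -exprS.
  - by rewrite -mulrA -exprD addnS -addSn exp_mulr_absorb.
  (* Self-adjointness moves [a * d] under the star, where it fixes [a ^+ k]. *)
  - rewrite mulrA -(mulrA (star _)) (mulr_exp_outerS _ _ _ _ h2) -hp.
    by rewrite -starM proj_fix_exp.
move=> x [[|j] [// _ hx _ hs]].
(* The exponent [j.+1] supplied with [x] may differ from [k]; this is harmless, as
   [a * d = a ^+ j.+1 * d ^+ j.+1] for every [j]. *)
have hax : a ^+ m.+2 * x = a * d * a ^+ m.+1.
  rewrite -(proj_fix R a d x k m.+2 h2 hk hx) -hp.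
  rewrite -(mulr_exp_outerS R a d j h2) starM -2!mulrA; congr (_ * _).
  by rewrite mulrA hs.
rewrite -[RHS](exp_mulr_cancel R a x d k m.+2 hk hx) -mulrA hax !mulrA.
congr (_ * _); rewrite -[RHS]mulrA exprSr -[RHS]mulrA; congr (_ * _).
by have := exp_mulr_cancel R a d d k 1 hk h2; rewrite !expr1 mulrA.
Qed.

Theorem theorem4p6 (R : pzRingType) (star : R -> R)
    (hstar : is_proper_involution star) (m : nat) (hm : (1 <= m)%N)
    (a d : R) (hd : is_core_EP_inverse star a d) :
  let p := a * d in
  let t := p * a * p in
  let s := p * a * (1 - p) in
  let n := (1 - p) * a * (1 - p) in
  forall (c : nat -> R) (hc1 : c 1%N = s)
    (hcS : forall i : nat, (0 < i)%N -> c i.+1 = t * c i + s * n ^+ i),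
  is_Pierce_matrix p a t s 0 n /\
  exists tinv : R, is_corner_inverse p t tinv /\
    exists w : R, unique (is_weak_group_inverse star m a) w /\
      is_Pierce_matrix p w tinv (tinv ^+ m.+1 * c m) 0 0.
Proof.
move=> p t s n c hc1 hcS.
have hw := weak_group_inverse_core_EP R star m a d hstar.1 hd hm.
case: hd => k [k0 h2 hp /esym hk].
have dpE : d * p = d.
  by have := exp_mulr_cancel R a d d k 1 hk h2; rewrite !expr1 -mulrA.
have pdE : p * d = d by rewrite /p -mulrA -expr2.
have ppE : p * p = p by rewrite {1}/p -mulrA dpE.
(* [a * p] is [a ^+ 2 * d], which [p] fixes on the left; so the lower-left block of [a] vanishes. *)
have papE : p * a * p = a * p.
  by have := proj_fix R a d d k 2 h2 hk h2; rewrite expr2 -/p -!mulrA.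
have pE : p = a * d by [].
clearbody p; have q_ap : (1 - p) * a * p = 0 by rewrite !mulrBl mul1r papE subrr.
have qaE : (1 - p) * a * (1 - p) = (1 - p) * a.
  by rewrite mulrBr mulr1 q_ap subr0.
have qqE : (1 - p) * (1 - p) = 1 - p.
  by rewrite mulrBr mulr1 mulrBl mul1r ppE subrr subr0.
have qqa u : (1 - p) * a * ((1 - p) * u) = (1 - p) * a * u.
  by rewrite mulrA qaE.
have anE i : (1 - p) * a ^+ i * (1 - p) = (1 - p) * a ^+ i.
  elim: i => [|i IHi]; first by rewrite expr0 mulr1 qqE.
  by rewrite exprS mulrA -qqa -mulrA IHi.
(* The factor [1 - p] on the left covers [i = 0], where [n ^+ 0] is [1] and not the identity of the
   corner. *)
have qnE i : (1 - p) * n ^+ i = (1 - p) * a ^+ i.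
  elim: i => [|i IHi]; first by rewrite !expr0.
  by rewrite !exprSr mulrA IHi /n qaE 2!mulrA anE.
have cE i : (0 < i)%N -> c i = p * a ^+ i * (1 - p).
  elim: i => // -[_ _|i IHi _]; first by rewrite hc1.
  (* The recursion is the upper-right block of [a] times a power of [a]: the middle factors [p] and
     [1 - p] add up to [1]. *)
  rewrite hcS // IHi // /t /s -(mulrA (p * a) (1 - p)) qnE -anE.
  rewrite [a ^+ i.+2]exprS; move: (a ^+ i.+1) => b; rewrite !mulrA -(mulrA _ p p) ppE.
  by rewrite -2!mulrDl -mulrDr (addrC p) subrK mulr1.
split.
  split=> //; split; last by rewrite q_ap.
  rewrite addr0 /t /s /n qaE -mulrDr (addrC p) subrK mulr1 -mulrDl.
  by rewrite (addrC p) subrK mul1r.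
exists d; split.
  split.
  - by exists a.
  - by exists d; rewrite pdE dpE.
  - by rewrite /t papE -mulrA pdE.
  (* For [d * t = p], write [a * d] as [a ^+ k * d ^+ k], possible since [k > 0]; then [d] meets
     [a ^+ k.+1] and [hk] applies. *)
  - rewrite /t papE pE -(prednK k0) in hk *.
    by rewrite -(mulr_exp_outerS R a d k.-1 h2) !mulrA -(mulrA d) -exprS hk.
exists (d ^+ m.+1 * a ^+ m); split => //.
have dpS i : d ^+ i.+1 * p = d ^+ i.+1 by rewrite exprSr -mulrA dpE.
have pdS i : p * d ^+ i.+1 = d ^+ i.+1 by rewrite exprS mulrA pdE.
have wpE : d ^+ m.+1 * a ^+ m * p = d.
  rewrite pE -!mulrA (mulrA (a ^+ m)) -exprSr mulrA.
  exact: exp_mulr_cancel hk h2.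
have pwE : p * (d ^+ m.+1 * a ^+ m) = d ^+ m.+1 * a ^+ m by rewrite mulrA pdS.
have dcE : d ^+ m.+1 * c m = d ^+ m.+1 * a ^+ m * (1 - p).
  by rewrite cE // !mulrA dpS.
split=> //; split.
  by rewrite !addr0 dcE mulrBr mulr1 wpE addrC subrK.
by rewrite mulrBl mul1r pwE wpE dcE subrr !mul0r.
Qed.
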